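(* Let $C$ be a finite set of SNF clauses over a finite set $AP$ of atomic propositions such that the temporal resolution procedure (described in the context) applied to $C$ terminates returning ''unsat''. Let $G$ be the resolution graph constructed during this run, let $v_\Box$ be the unique vertex of the main partition $M^V$ of $G$ labeled with the empty clause $\Box$, and let $C^{uc}$ be the UC of $C$ in SNF, i.e. the set of clauses $c\in C$ such that some vertex $v\in M^V$ labeled with $c$ is backward reachable in $G$ from $v_\Box$ (including $v_\Box$ itself). Then $C^{uc}$ is unsatisfiable.
   Context: LTL is interpreted over infinite sequences of valuations of $AP$ (positions $0,1,2,\dots$), with the usual operators $\neg,\vee,\wedge,\mathbf{X},\mathbf{F},\mathbf{G}$. A literal is $p$ or $\neg p$ for $p\in AP$. In what follows $P,Q,R,S$ denote (possibly empty) disjunctions of pairwise different literals and $l$ a literal; empty disjunctions are $0$ (false). SNF clauses are: initial clauses $P$ (holding at position 0); global clauses $\mathbf{G}(P\vee \mathbf{X}Q)$ (the ''$\mathbf{X}$ part'' is $Q$; if $Q$ is empty we write $\mathbf{G}(P)$); eventuality clauses $\mathbf{G}(P\vee\mathbf{F}l)$ with eventuality literal $l$. The empty clause $\Box$ is the empty initial clause ($0$) or $\mathbf{G}(0)$. A set of SNF clauses denotes the conjunction of its clauses and is (un)satisfiable accordingly. For each eventuality literal $l$, $w_l$ denotes a fresh proposition not occurring in $C$. Production rules (each conclusion is placed in a partition: the main partition $M$, the current loop partition $L$, or for step-xx either $M$ or $L$ with premises and conclusion in the same partition). Each rule is annotated with which premises get an edge to the conclusion's vertex. Saturation rules (all in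 $M$, except step-xx): init-ii: initial $P\vee l$, initial $\neg l\vee Q$ $\Rightarrow$ initial $P\vee Q$ (edges from both); init-in: initial $P\vee l$, $\mathbf{G}(\neg l\vee Q)$ $\Rightarrow$ initial $P\vee Q$ (both); step-nn: $\mathbf{G}(P\vee l)$, $\mathbf{G}(\neg l\vee Q)$ $\Rightarrow$ $\mathbf{G}(P\vee Q)$ (both); step-nx: $\mathbf{G}(P\vee l)$, $\mathbf{G}(Q\vee\mathbf{X}(\neg l\vee R))$ $\Rightarrow$ $\mathbf{G}(Q\vee\mathbf{X}(P\vee R))$ (both); step-xx: $\mathbf{G}(P\vee\mathbf{X}(Q\vee l))$, $\mathbf{G}(R\vee\mathbf{X}(\neg l\vee S))$ $\Rightarrow$ $\mathbf{G}(P\vee R\vee\mathbf{X}(Q\vee S))$ (both). Augmentation (in $M$): aug1: $\mathbf{G}(P\vee\mathbf{F}l)$ $\Rightarrow$ $\mathbf{G}(P\vee l\vee w_l)$ (edge from premise); aug2: $\mathbf{G}(P\vee\mathbf{F}l)$ $\Rightarrow$ $\mathbf{G}(\neg w_l\vee\mathbf{X}(l\vee w_l))$ (no edge). Loop search: loop-it-init-x: a global clause $c=\mathbf{G}(P\vee\mathbf{X}Q)$ of $M$ with $Q$ nonempty $\Rightarrow$ a copy of $c$ in $L$ (edge); loop-it-init-n: $\mathbf{G}(P)$ in $M$ $\Rightarrow$ $\mathbf{G}(\mathbf{X}P)$ in $L$ (edge); loop-it-init-c: $\mathbf{G}(P)$ from the previous loop partition $L'$ (or $\Box$) and eventuality clause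 $\mathbf{G}(Q\vee\mathbf{F}l)$ in $M$ $\Rightarrow$ $\mathbf{G}(\mathbf{X}(P\vee l))$ in $L$ (new vertex, no edges); loop-it-sub: a clause $c=\mathbf{G}(P)$ in $L$ with $c$ implying $\mathbf{G}(Q)$, and a clause $\mathbf{G}(\mathbf{X}(Q\vee l))$ in $L$ generated by loop-it-init-c $\Rightarrow$ no new clause/vertex, but an edge from the vertex of $c$ to the vertex of $\mathbf{G}(\mathbf{X}(Q\vee l))$; loop-conc1: $\mathbf{G}(P)$ in $L$, $\mathbf{G}(Q\vee\mathbf{F}l)$ in $M$ $\Rightarrow$ $\mathbf{G}(P\vee Q\vee l)$ in $M$ (edges from both); loop-conc2: same premises $\Rightarrow$ $\mathbf{G}(\neg w_l\vee\mathbf{X}(P\vee l))$ in $M$ (edge from the first premise $\mathbf{G}(P)$ only). To saturate a set means applying the relevant rules until no new clauses arise. Procedure: $M:=C$; if $\Box\in M$ return unsat. Saturate $M$ (init-ii, init-in, step-nn, step-nx, step-xx); if $\Box\in M$ return unsat. Augment: apply aug1 to each eventuality clause in $M$ and aug2 once per eventuality literal. Saturate $M$; if $\Box\in M$ return unsat. $M':=\emptyset$. While $M'\neq M$: $M':=M$; for each eventuality clause $c\in C$ with eventuality literal $l$: $C':=\{\Box\}$; repeat: create a new loop partition $L$, initialized by applying loop-it-init-x to each global clause of $M$ with nonempty $\mathbf{X}$ part, loop-it-init-n to each global clause of $M$ with empty $\mathbf{X}$ part, and loop-it-init-c to each clause of $C'$ together with $c$; saturate $L$ using only step-xx; $C':=$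 clauses of $L$ with empty $\mathbf{X}$ part; $C'':=\{\mathbf{G}(Q)\mid \mathbf{G}(\mathbf{X}(Q\vee l))\in L$ generated by loop-it-init-c$\}$; found $:=$ every clause of $C''$ is subsumed by some clause of $C'$ (each such subsumption recorded as a loop-it-sub application); until found or $C'=\emptyset$. If found: apply loop-conc1 and loop-conc2 to each clause of $C'$ together with $c$; saturate $M$; if $\Box\in M$ return unsat. Finally return sat. Resolution graph $G$: a directed graph whose vertices are labeled with SNF clauses and partitioned into a main partition $M^V$ and one partition $L^V_i$ per loop search iteration. Initially it has one vertex in $M^V$ labeled $c$ for each $c\in C$ and no edges. For each rule application that generates a new clause in $M$ or $L$, or is the first application of loop-it-sub to a clause of $C''$: if the rule creates a vertex, a new vertex labeled with the conclusion is put in the corresponding partition; edges are added from the vertices of the premises to the vertex of the conclusion exactly as annotated above. *)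

(* Defs.v *)
From HB Require Import structures.
From mathcomp Require Import all_boot.

Set Implicit Arguments.
Unset Strict Implicit.
Unset Printing Implicit Defensive.

(* (p, true) is the literal p, (p, false) is the literal ~ p. *)
Notation lit V := (V * bool)%type.
Definition neg (V : finType) (l : lit V) : lit V := (l.1, ~~ l.2).

(* A disjunction of pairwise different literals, up to reordering; set0 is 0. *)
Notation dis V := {set lit V}.

(* Init P is P at position 0, Glob P Q is G(P \/ X Q), with Glob P set0
   standing for G(P), and Event P l is G(P \/ F l). *)
Inductive clause (V : finType) : Type :=
  | Init of dis V
  | Glob of dis V & dis V
  | Event of dis V & lit V.
Arguments Init {V}.
Arguments Glob {V}.
Arguments Event {V}.

Section ClauseFinite.
Variable V : finType.

Definition clause_code (c : clause V) : dis V + dis V * dis V + dis V * lit V :=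
  match c with
  | Init P => inl (inl P)
  | Glob P Q => inl (inr (P, Q))
  | Event P l => inr (P, l)
  end.

Definition clause_decode (x : dis V + dis V * dis V + dis V * lit V) : clause V :=
  match x with
  | inl (inl P) => Init P
  | inl (inr (P, Q)) => Glob P Q
  | inr (P, l) => Event P l
  end.

Lemma clause_codeK : cancel clause_code clause_decode.
Proof. by case. Qed.

HB.instance Definition _ := Finite.copy (clause V) (can_type clause_codeK).
End ClauseFinite.

Definition is_box (V : finType) (c : clause V) : bool :=
  (c == Init set0) || (c == Glob set0 set0).

Section Semantics.
Variable V : finType.
Implicit Types (s : nat -> V -> bool) (P Q : dis V) (c : clause V).

Definition lit_holds s (i : nat) (l : lit V) : Prop := s i l.1 = l.2.

Definition dis_holds s i P : Prop := exists2 l, l \in P & lit_holds s i l.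

Definition holds s c : Prop :=
  match c with
  | Init P => dis_holds s 0 P
  | Glob P Q => forall i, dis_holds s i P \/ dis_holds s i.+1 Q
  | Event P l =>
      forall i, dis_holds s i P \/ exists2 j, i <= j & lit_holds s j l
  end.

Definition satisfiable (S : {set clause V}) : Prop :=
  exists s, forall c, c \in S -> holds s c.

Definition implies c d : Prop := forall s, holds s c -> holds s d.
End Semantics.

(* The propositions of AP together with the fresh propositions w_l. *)
Definition atom (AP : finType) : finType := (AP + lit AP)%type.

Section Extension.
Variable AP : finType.

Definition xlit (l : lit AP) : lit (atom AP) := (inl l.1, l.2).
Definition wlit (l : lit AP) : lit (atom AP) := (inr l, true).

Definition xdis (P : dis AP) : dis (atom AP) := [set xlit l | l in P].

Definition xclause (c : clause AP) : clause (atom AP) :=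
  match c with
  | Init P => Init (xdis P)
  | Glob P Q => Glob (xdis P) (xdis Q)
  | Event P l => Event (xdis P) (xlit l)
  end.
End Extension.

(* Partitions of the resolution graph: the main one and, for each iteration of
   a loop search, a loop partition. *)
Notation part := (option nat).
Definition Main : part := None.
Definition Loop (k : nat) : part := Some k.

(* Vertex v carries the partition and the label found at index v of
   [gverts]. Every clause of M (of L) labels a vertex of the corresponding
   partition, so M and L are read off the graph. *)
Record graph (V : finType) := Graph {
  gverts : seq (part * clause V);
  gedges : seq (nat * nat)
}.

Section Graphs.
Variable V : finType.
Implicit Types (g : graph V) (p : part) (c : clause V) (v : nat).

Definition vertex g := 'I_(size (gverts g)).

Definition labelled g v p c : bool := onth (gverts g) v == Some (p, c).

Definition clauses g p : {set clause V} := [set c | (p, c) \in gverts g].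

Definition has_box g : bool := [exists c in clauses g Main, is_box c].

(* The clauses with empty X part, each given by its disjunction. *)
Definition nclauses g p : {set dis V} := [set P | Glob P set0 \in clauses g p].

(* Effect of a rule application with conclusion a.1 and an edge from each
   vertex of a.2: only a new clause changes the graph. *)
Definition put p g (a : clause V * seq nat) : graph V :=
  if a.1 \in clauses g p then g
  else Graph (rcons (gverts g) (p, a.1))
             (gedges g ++ [seq (v, size (gverts g)) | v <- a.2]).

(* Carries out, in some order, all the applications described by [app]. *)
Definition apply_each (app : clause V -> seq nat -> Prop) p g g' : Prop :=
  exists s : seq (clause V * seq nat),
    (forall a, a \in s <-> app a.1 a.2) /\ g' = foldl (put p) g s.

(* The side conditions make the premises disjunctions of pairwise different
   literals, so that the literal resolved upon leaves both premises. *)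
Inductive loop_rule : clause V -> clause V -> clause V -> Prop :=
  | step_xx (P Q R S : dis V) (l : lit V) of l \notin Q & neg l \notin S :
      loop_rule (Glob P (l |: Q)) (Glob R (neg l |: S))
                (Glob (P :|: R) (Q :|: S)).

Inductive main_rule : clause V -> clause V -> clause V -> Prop :=
  | init_ii (P Q : dis V) (l : lit V) of l \notin P & neg l \notin Q :
      main_rule (Init (l |: P)) (Init (neg l |: Q)) (Init (P :|: Q))
  | init_in (P Q : dis V) (l : lit V) of l \notin P & neg l \notin Q :
      main_rule (Init (l |: P)) (Glob (neg l |: Q) set0) (Init (P :|: Q))
  | step_nn (P Q : dis V) (l : lit V) of l \notin P & neg l \notin Q :
      main_rule (Glob (l |: P) set0) (Glob (neg l |: Q) set0)
                (Glob (P :|: Q) set0)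
  | step_nx (P Q R : dis V) (l : lit V) of l \notin P & neg l \notin R :
      main_rule (Glob (l |: P) set0) (Glob Q (neg l |: R)) (Glob Q (P :|: R))
  | main_xx c1 c2 c of loop_rule c1 c2 c :
      main_rule c1 c2 c.

Inductive rule_step (rule : clause V -> clause V -> clause V -> Prop) p g :
    graph V -> Prop :=
  | RuleStep v1 v2 c1 c2 c of
      labelled g v1 p c1 & labelled g v2 p c2 & rule c1 c2 c
      & c \notin clauses g p :
      rule_step rule p g (put p g (c, [:: v1; v2])).

Inductive saturates (rule : clause V -> clause V -> clause V -> Prop) p :
    graph V -> graph V -> Prop :=
  | saturates_done g of (forall g', ~ rule_step rule p g g') :
      saturates rule p g g
  | saturates_step g1 g2 g3 of
      rule_step rule p g1 g2 & saturates rule p g2 g3 :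
      saturates rule p g1 g3.
End Graphs.

Section Procedure.
Variable AP : finType.
Notation V := (atom AP).
Implicit Types (C : {set clause AP}) (g : graph V) (prev : {set dis V}).

Definition start C : graph V :=
  Graph [seq (Main, xclause c) | c <- enum C] [::].

(* aug2 concludes the same clause for all eventuality clauses sharing an
   eventuality literal, and [put] adds it once. *)
Inductive augmentation g : clause V -> seq nat -> Prop :=
  | aug1 v P l of labelled g v Main (xclause (Event P l)) :
      augmentation g (Glob (xdis P :|: [set xlit l; wlit l]) set0) [:: v]
  | aug2 v P l of labelled g v Main (xclause (Event P l)) :
      augmentation g (Glob [set neg (wlit l)] [set xlit l; wlit l]) [::].

(* In the loop search for the eventuality clause Event R l, [prev] holds the
   disjunctions P of the clauses G(P) of C'. *)
Inductive loop_init g (R : dis AP) (l : lit AP) prev :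
    clause V -> seq nat -> Prop :=
  | loop_it_init_x v P Q of labelled g v Main (Glob P Q) & Q != set0 :
      loop_init g R l prev (Glob P Q) [:: v]
  | loop_it_init_n v P of labelled g v Main (Glob P set0) :
      loop_init g R l prev (Glob set0 P) [:: v]
  | loop_it_init_c u P of
      P \in prev & labelled g u Main (xclause (Event R l)) :
      loop_init g R l prev (Glob set0 (xlit l |: P)) [::].

(* C'': the clauses G(X(Q \/ l)) generated by loop_it_init_c are those with
   G(Q) in [prev]. *)
Definition targets g k (l : lit AP) prev : {set dis V} :=
  [set Q in prev | Glob set0 (xlit l |: Q) \in clauses g (Loop k)].

Definition subsumes (P Q : dis V) : Prop :=
  implies (Glob P set0) (Glob Q set0).

(* loop-it-sub: each Q in C'' subsumed by some clause of L gets one edge, from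
   a subsuming clause [f Q] to the vertex of G(X(Q \/ l)). *)
Definition record_subs k (l : lit AP) prev g g' : Prop :=
  exists f : dis V -> option nat,
    (forall Q, Q \in targets g k l prev ->
       match f Q with
       | Some v => exists2 P, labelled g v (Loop k) (Glob P set0)
                            & subsumes P Q
       | None => forall P, P \in nclauses g (Loop k) -> ~ subsumes P Q
       end)
    /\ g' = Graph (gverts g)
              (gedges g ++
               pmap (fun Q => omap (fun v =>
                       (v, index (Loop k, Glob set0 (xlit l |: Q)) (gverts g)))
                       (f Q))
                    (enum (targets g k l prev))).

Definition found g k l prev : Prop :=
  forall Q, Q \in targets g k l prev ->
    exists2 P, P \in nclauses g (Loop k) & subsumes P Q.

Inductive loop_iteration R l prev k g : graph V -> Prop :=
  | LoopIteration g1 g2 g3 of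
      (clauses g (Loop k) = set0)
      & apply_each (loop_init g R l prev) (Loop k) g g1
      & saturates (@loop_rule V) (Loop k) g1 g2
      & record_subs k l prev g2 g3 :
      loop_iteration R l prev k g g3.

Inductive loop_conc g k (R : dis AP) (l : lit AP) : clause V -> seq nat -> Prop :=
  | loop_conc1 v u P of
      labelled g v (Loop k) (Glob P set0)
      & labelled g u Main (xclause (Event R l)) :
      loop_conc g k R l (Glob (P :|: xdis R :|: [set xlit l]) set0) [:: v; u]
  | loop_conc2 v u P of
      labelled g v (Loop k) (Glob P set0)
      & labelled g u Main (xclause (Event R l)) :
      loop_conc g k R l (Glob [set neg (wlit l)] (P :|: [set xlit l])) [:: v].

Inductive loop_search R l : {set dis V} -> graph V -> graph V -> Prop :=
  | loop_found prev k g g1 g2 g3 of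
      loop_iteration R l prev k g g1 & found g1 k l prev
      & apply_each (loop_conc g1 k R l) Main g1 g2
      & saturates (@main_rule V) Main g2 g3 :
      loop_search R l prev g g3
  | loop_fail prev k g g1 of
      loop_iteration R l prev k g g1 & ~ found g1 k l prev
      & nclauses g1 (Loop k) = set0 :
      loop_search R l prev g g1
  | loop_again prev k g g1 g2 of
      loop_iteration R l prev k g g1 & ~ found g1 k l prev
      & nclauses g1 (Loop k) <> set0
      & loop_search R l (nclauses g1 (Loop k)) g1 g2 :
      loop_search R l prev g g2.

Inductive verdict := SAT | UNSAT.

(* One pass over a list of eventuality clauses; the boolean tells whether the
   pass ended with the empty clause in M. The initial {[]} of C' is
   [set set0]. *)
Inductive pass : seq (dis AP * lit AP) -> graph V -> bool -> graph V -> Prop :=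
  | pass_nil g : pass [::] g false g
  | pass_box R l es g g1 of
      loop_search R l [set set0] g g1 & has_box g1 :
      pass ((R, l) :: es) g true g1
  | pass_next R l es g g1 b g2 of
      loop_search R l [set set0] g g1 & ~~ has_box g1 & pass es g1 b g2 :
      pass ((R, l) :: es) g b g2.

Definition events_of C (es : seq (dis AP * lit AP)) : Prop :=
  uniq es /\ forall e, (e \in es) = (Event e.1 e.2 \in C).

Inductive main_loop C : {set clause V} -> graph V -> verdict -> graph V -> Prop :=
  | main_exit M' g of M' = clauses g Main :
      main_loop C M' g SAT g
  | main_box M' es g g1 of
      M' <> clauses g Main & events_of C es & pass es g true g1 :
      main_loop C M' g UNSAT g1
  | main_next M' es g g1 r g2 of
      M' <> clauses g Main & events_of C es & pass es g false g1
      & main_loop C (clauses g Main) g1 r g2 :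
      main_loop C M' g r g2.

(* [run C r g]: some run on C terminates returning r, with resolution graph g. *)
Inductive run C : verdict -> graph V -> Prop :=
  | run_input of has_box (start C) :
      run C UNSAT (start C)
  | run_saturate g1 of
      ~~ has_box (start C)
      & saturates (@main_rule V) Main (start C) g1 & has_box g1 :
      run C UNSAT g1
  | run_augment g1 g2 g3 of
      ~~ has_box (start C)
      & saturates (@main_rule V) Main (start C) g1 & ~~ has_box g1
      & apply_each (augmentation g1) Main g1 g2
      & saturates (@main_rule V) Main g2 g3 & has_box g3 :
      run C UNSAT g3
  | run_loop g1 g2 g3 r g of
      ~~ has_box (start C)
      & saturates (@main_rule V) Main (start C) g1 & ~~ has_box g1
      & apply_each (augmentation g1) Main g1 g2
      & saturates (@main_rule V) Main g2 g3 & ~~ has_box g3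
      & main_loop C set0 g3 r g :
      run C r g.

(* M may end up containing both empty clauses, 0 and G(0); each of them labels at
   most one vertex. *)
Definition box_vertex g (v : vertex g) : Prop :=
  exists2 c, is_box c & labelled g v Main c.

Definition edge g : rel (vertex g) := fun u v => (val u, val v) \in gedges g.

Definition uc C g (vbox : vertex g) : {set clause AP} :=
  [set c in C | [exists u : vertex g,
     labelled g u Main (xclause c) && connect (@edge g) u vbox]].
End Procedure.

(* Main.v *)
Require Import Defs.
From mathcomp Require Import all_boot.
From mathcomp Require Import boolp.

Set Implicit Arguments.
Unset Strict Implicit.
Unset Printing Implicit Defensive.

(** Let s be a model of the core, and extend it by reading [w_l] as X F l. Then
    every clause of M that reaches the empty clause holds in s, by induction
    along the run. The only delicate case is a successful loop search. Its
    clauses are derived pointwise from clauses of M and from the clauses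
    G(X(Q \/ l)). So if a reaching G(P) of L fails at position i, then Q and l
    fail at i+1 for some reaching G(X(Q \/ l)). The edge of loop-it-sub makes
    the clause of L that subsumes G(Q) reaching as well, and it fails at i+1.
    Iterating, l fails at every later position: P \/ X F l holds everywhere,
    which justifies both loop conclusions. *)

(** * Truth of disjunctions and soundness of the resolution rules *)

Section Disjunctions.
Variables (V : finType) (s : nat -> V -> bool).
Implicit Types (P Q R S : dis V) (l : lit V) (i : nat).

Lemma dis_holds0 i : ~ dis_holds s i set0.
Proof. by case=> l; rewrite inE. Qed.

Lemma dis_holds1 i l : dis_holds s i [set l] <-> lit_holds s i l.
Proof.
split; first by case=> l' /set1P ->.
by move=> sl; exists l; rewrite ?set11.
Qed.

Lemma dis_holdsU i P Q :
  dis_holds s i (P :|: Q) <-> dis_holds s i P \/ dis_holds s i Q.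
Proof.
split.
  by case=> l /setUP[] lP sl; [left|right]; exists l.
by case=> -[l lP sl]; exists l => //; rewrite inE lP ?orbT.
Qed.

Lemma dis_holdsU1 i l P :
  dis_holds s i (l |: P) <-> lit_holds s i l \/ dis_holds s i P.
Proof. by rewrite dis_holdsU dis_holds1. Qed.

Lemma lit_holds_neg i l : lit_holds s i (neg l) <-> ~ lit_holds s i l.
Proof. by case: l => p b; rewrite /lit_holds /=; case: (s i p) b => -[]. Qed.

Lemma resolution i l P Q : dis_holds s i (l |: P) ->
  dis_holds s i (neg l |: Q) -> dis_holds s i (P :|: Q).
Proof. by rewrite !dis_holdsU1 dis_holdsU lit_holds_neg; tauto. Qed.

Lemma loop_rule_holds c1 c2 c :
  loop_rule c1 c2 c -> holds s c1 -> holds s c2 -> holds s c.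
Proof.
case=> P Q R S l _ _ /= h1 h2 i; rewrite [dis_holds s i _]dis_holdsU.
have [?|h1'] := h1 i; first by do 2!left.
have [?|h2'] := h2 i; first by left; right.
by right; apply: resolution h1' h2'.
Qed.

Lemma main_rule_holds c1 c2 c :
  main_rule c1 c2 c -> holds s c1 -> holds s c2 -> holds s c.
Proof.
case=> [P Q l _ _|P Q l _ _|P Q l _ _|P Q R l _ _|c1' c2' c'] /=.
- exact: resolution.
- by move=> h1 /(_ 0)[|/dis_holds0//]; apply: resolution.
- move=> h1 h2 i; left.
  have [h1'|/dis_holds0//] := h1 i; have [h2'|/dis_holds0//] := h2 i.
  exact: resolution h1' h2'.
- move=> h1 h2 i; have [h1'|/dis_holds0//] := h1 i.+1.
  by have [h2'|h2'] := h2 i; [left|right; apply: resolution h1' h2'].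
- exact: loop_rule_holds.
Qed.

End Disjunctions.

(** * Growth of the resolution graph along a run *)

Section Growth.
Variable V : finType.
Implicit Types (g h : graph V) (p : part) (c : clause V) (v : nat).

(** The prefix keeps vertex numbers and first occurrences of labels stable, so one set of numbers
    can be tested against every graph of a run. *)
Definition extends g h : Prop :=
  prefix (gverts g) (gverts h) /\ {subset gedges g <= gedges h}.

Definition grows p g h : Prop :=
  extends g h /\
  forall v q c, q <> p -> labelled h v q c -> labelled g v q c.

Lemma labelled_mem g v p c : labelled g v p c -> (p, c) \in gverts g.
Proof. by move=> /eqP gv; apply/onthP; exists v. Qed.

Lemma labelled_lt g v p c : labelled g v p c -> v < size (gverts g).
Proof. by rewrite /labelled; case: ltnP => // /onth_default->. Qed.

Lemma extends_refl g : extends g g.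
Proof. by split=> //; apply: prefix_refl. Qed.

Lemma extends_trans h g g' : extends g h -> extends h g' -> extends g g'.
Proof.
move=> [p1 e1] [p2 e2]; split; first exact: prefix_trans p1 p2.
by move=> e /e1 /e2.
Qed.

Lemma extends_labelled g h v p c :
  extends g h -> labelled g v p c -> labelled h v p c.
Proof.
move=> [/prefixP[t gt] _] gv; have vlt := labelled_lt gv.
by move: gv; rewrite /labelled gt onth_cat vlt.
Qed.

Lemma extends_index g h x : extends g h -> x \in gverts g ->
  index x (gverts h) = index x (gverts g).
Proof. by move=> [/prefixP[t ->] _] xg; rewrite index_cat xg. Qed.

Lemma grows_refl p g : grows p g g.
Proof. by split=> //; apply: extends_refl. Qed.

Lemma grows_trans p h g g' : grows p g h -> grows p h g' -> grows p g g'.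
Proof.
move=> [e1 l1] [e2 l2]; split; first exact: extends_trans e1 e2.
by move=> v q c qp /(l2 _ _ _ qp) /(l1 _ _ _ qp).
Qed.

Lemma labelled_rcons g es x v p c :
  labelled (Graph (rcons (gverts g) x) es) v p c ->
  labelled g v p c \/ v = size (gverts g) /\ x = (p, c).
Proof.
rewrite /labelled /= -cats1 onth_cat.
case: ltngtP => [_|vgt|->]; [by left| |].
  by rewrite onth_default // subn_gt0.
by rewrite subnn => /eqP[]; right.
Qed.

Lemma put_grows p g a : grows p g (put p g a).
Proof.
rewrite /put; case: ifP => _; first exact: grows_refl.
split; first split=> /=.
- by rewrite -cats1 prefix_prefix.
- by move=> e eg; rewrite mem_cat eg.
- by move=> v q c qp /labelled_rcons[//|[_ [pq]]]; case: qp.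
Qed.

Lemma foldl_put_grows p (s : seq (clause V * seq nat)) g :
  grows p g (foldl (put p) g s).
Proof.
elim: s g => [|a s IHs] g /=; first exact: grows_refl.
exact: grows_trans (put_grows p g a) (IHs _).
Qed.

Lemma apply_each_grows app p g g' : apply_each app p g g' -> grows p g g'.
Proof. by case=> s [_ ->]; apply: foldl_put_grows. Qed.

Lemma saturates_grows rule p g g' : saturates rule p g g' -> grows p g g'.
Proof.
elim=> [h _|g1 g2 g3 step _]; first exact: grows_refl.
by apply: grows_trans; case: step => *; apply: put_grows.
Qed.

End Growth.

(** * Invariants restricted to a backward closed set of vertices *)

Definition backward_closed (V : finType) (g : graph V) (A : nat -> Prop) :=
  forall u v, (u, v) \in gedges g -> u < size (gverts g) -> A v -> A u.

Section Reaching.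
Variables (V : finType) (gf : graph V) (A : nat -> Prop).
Hypothesis backward : backward_closed gf A.
Implicit Types (g : graph V) (p : part) (T : clause V -> Prop).

Definition upheld p T g : Prop :=
  forall v c, labelled g v p c -> A v -> T c.

(** Local soundness of one application: only premises with an edge to the conclusion may be used.
    The conclusion's vertex is named by its first occurrence in [gf], which does not depend on when
    the application takes place. *)
Definition supports p T (a : clause V * seq nat) : Prop :=
  (p, a.1) \in gverts gf -> A (index (p, a.1) (gverts gf)) ->
  (forall v, v \in a.2 -> v < size (gverts gf) -> A v) -> T a.1.

(** A clause already present changes nothing. A new one brings its edges into [gf], so if its vertex
    is in [A], backward closure puts the recorded premises in [A]. *)
Lemma put_upheld p T g a : extends (put p g a) gf -> supports p T a ->
  upheld p T g -> upheld p T (put p g a).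
Proof.
rewrite /put; case: ifPn => //; rewrite inE => anew gext sup up v c.
move=> lab; have [gv|[-> [ac]]] := labelled_rcons lab; first exact: up gv.
have ag : (p, a.1) \in rcons (gverts g) (p, a.1) by rewrite mem_rcons mem_head.
(* The label is new in [g], so its first occurrence is the vertex just appended, and later growth
   does not move it. *)
have ixE : index (p, a.1) (gverts gf) = size (gverts g).
  rewrite (extends_index gext) //=.
  by rewrite -cats1 index_cat (negPf anew) /= eqxx addn0.
rewrite -ac => Anew; apply: sup => [||u ua ult]; rewrite ?ixE //.
  by have /prefixP[t ->] := gext.1; rewrite mem_cat ag.
apply: backward ult Anew; apply: gext.2.
by rewrite mem_cat (map_f (fun v => (v, _))) ?orbT.
Qed.

Lemma apply_each_upheld app p T g g' :
  apply_each app p g g' -> extends g' gf ->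
  (forall c vs, app c vs -> supports p T (c, vs)) ->
  upheld p T g -> upheld p T g'.
Proof.
case=> s [appP ->] + sup.
have {appP}: forall a, a \in s -> supports p T a.
  by move=> [c vs] /appP /sup.
elim: s g {sup} => [//|a s IHs] g /= sup fin up.
apply: IHs => // [b bs|]; first by apply: sup; rewrite inE bs orbT.
apply: put_upheld up; last by apply: sup; rewrite mem_head.
by apply: extends_trans fin; case: (foldl_put_grows p s (put p g a)).
Qed.

Lemma saturates_upheld rule p T g g' :
  saturates rule p g g' -> extends g' gf ->
  (forall c1 c2 c, rule c1 c2 c -> T c1 -> T c2 -> T c) ->
  upheld p T g -> upheld p T g'.
Proof.
move=> sat + ruleT; elim: sat => [//|g1 g2 g3 step sat IH] fin up.
have [ext23 _] := saturates_grows sat.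
apply: IH => //; have := extends_trans ext23 fin; move: up.
case: step => v1 v2 c1 c2 c lab1 lab2 r _ up fin2.
apply: (put_upheld fin2) (up) => _ _ prem.
have [ext12 _] := put_grows p g1 (c, [:: v1; v2]).
have lt v c' (lab : labelled g1 v p c') : v < size (gverts gf).
  exact: labelled_lt (extends_labelled fin2 (extends_labelled ext12 lab)).
apply: ruleT r (up _ _ lab1 _) (up _ _ lab2 _); apply: prem.
- by rewrite !inE eqxx.
- exact: lt lab1.
- by rewrite !inE eqxx orbT.
- exact: lt lab2.
Qed.

End Reaching.

(** * The extended model and the reaching clauses of the main partition *)

Section Run.
Variables (AP : finType) (gf : graph (atom AP)) (A : nat -> Prop).
Hypothesis backward : backward_closed gf A.
Variable s : nat -> AP -> bool.
Implicit Types (g : graph (atom AP)) (P Q : dis (atom AP)) (R : dis AP).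
Implicit Types (l : lit AP) (prev : {set dis (atom AP)}) (k i j : nat).

Definition wait_model i (x : atom AP) : bool :=
  match x with
  | inl p => s i p
  | inr l => `[< exists2 j, i < j & lit_holds s j l >]
  end.
Notation sw := wait_model.

Lemma lit_holds_wlit i l :
  lit_holds sw i (wlit l) <-> exists2 j, i < j & lit_holds s j l.
Proof. by rewrite /lit_holds /=; split=> /asboolP. Qed.

Lemma dis_holds_xdis i R : dis_holds sw i (xdis R) <-> dis_holds s i R.
Proof.
split; first by case=> _ /imsetP[l lR ->] sl; exists l.
by case=> l lR sl; exists (xlit l); first exact: imset_f.
Qed.

Lemma holds_xclause (c : clause AP) : holds s c -> holds sw (xclause c).
Proof.
case: c => [P|P Q|P l] /=; first by rewrite dis_holds_xdis.
  by move=> h i; rewrite !dis_holds_xdis.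
move=> h i; rewrite dis_holds_xdis.
by have [|[j ij sl]] := h i; [left|right; exists j].
Qed.

(* Only the value at position i matters: repeat it forever. *)
Lemma subsumes_dis_holds P Q i :
  subsumes P Q -> dis_holds sw i P -> dis_holds sw i Q.
Proof.
move=> PQ [l lP sl].
have: holds (fun=> sw i) (Glob P set0) by move=> j; left; exists l.
by move=> /PQ /(_ 0)[[l' l'Q sl']|/dis_holds0//]; exists l'.
Qed.


Definition reaching_holds g : Prop := upheld A Main (holds sw) g.

(** [A] is read in the final graph, so the invariant is claimed only for graphs that [gf] extends.
    Keeping [extends] as a conjunct passes this guard back to earlier graphs when steps are
    composed. *)
Definition sound_growth g g' : Prop :=
  extends g g' /\ (extends g' gf -> reaching_holds g -> reaching_holds g').

Lemma sound_growth_refl g : sound_growth g g.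
Proof. by split=> //; apply: extends_refl. Qed.

Lemma sound_growth_trans h g g' :
  sound_growth g h -> sound_growth h g' -> sound_growth g g'.
Proof.
move=> [e1 up1] [e2 up2]; split=> [|fin up]; first exact: extends_trans e1 e2.
by apply: up2 fin (up1 (extends_trans e2 fin) up).
Qed.

Lemma saturates_main g g' :
  saturates (@main_rule _) Main g g' -> sound_growth g g'.
Proof.
move=> sat; split=> [|fin]; first by case: (saturates_grows sat).
apply: (saturates_upheld backward sat fin) => c1 c2 c.
exact: main_rule_holds.
Qed.

Lemma wait_model_unfold i l : lit_holds sw i (wlit l) ->
  dis_holds sw i.+1 [set xlit l; wlit l].
Proof.
rewrite dis_holdsU !dis_holds1 !lit_holds_wlit => -[j].
rewrite leq_eqVlt => /predU1P[<-|ij] sl; first by left.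
by right; exists j.
Qed.

Lemma eventually_wait i j l : i <= j -> lit_holds sw j (xlit l) ->
  dis_holds sw i [set xlit l; wlit l].
Proof.
rewrite dis_holdsU !dis_holds1 lit_holds_wlit leq_eqVlt.
by case/predU1P=> [<-|ij] sl; [left|right; exists j].
Qed.

(** The edge of aug1 makes its premise reaching, hence true. An aug2 clause has no edge and must
    hold outright: it is the unfolding of X F l into X (l or X F l). *)
Lemma augmentation_main g g' :
  apply_each (augmentation g) Main g g' -> sound_growth g g'.
Proof.
move=> app; have [ext _] := apply_each_grows app; split=> // fin up.
apply: (apply_each_upheld backward app fin) (up) => c vs.
case=> v P l lab _ _ /=.
  move=> prem i; left; rewrite dis_holdsU.
  have Av : A v.
    apply: prem; rewrite ?mem_head //.
    by apply: labelled_lt (extends_labelled (extends_trans ext fin) lab).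
  have [?|[j ij sl]] := up _ _ lab Av i; first by left.
  by right; apply: eventually_wait ij sl.
move=> _ i; rewrite dis_holds1 lit_holds_neg.
by have [/wait_model_unfold|] := EM (lit_holds sw i (wlit l)); [right|left].
Qed.

(** * Loop searches *)

(** A clause of L may rest on loop-it-init-c clauses, which need not hold in the model. The third
    alternative blames a failure at [i] on a reaching clause of that kind failing at the same [i];
    step-xx preserves this pointwise. *)
Definition loop_holds g k l prev (c : clause (atom AP)) : Prop :=
  if c is Glob P Q then
    forall i, [\/ dis_holds sw i P, dis_holds sw i.+1 Q
      | exists Q0, [/\ Q0 \in prev,
          (Loop k, Glob set0 (xlit l |: Q0)) \in gverts g,
          A (index (Loop k, Glob set0 (xlit l |: Q0)) (gverts g))
        & ~ dis_holds sw i.+1 (xlit l |: Q0)]]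
  else True.

Lemma loop_holdsW g k l prev c : holds sw c -> loop_holds g k l prev c.
Proof. by case: c => //= P Q h i; case: (h i) => ?; [apply: Or31|apply: Or32]. Qed.

Lemma loop_rule_loop_holds g k l prev c1 c2 c : loop_rule c1 c2 c ->
  loop_holds g k l prev c1 -> loop_holds g k l prev c2 ->
  loop_holds g k l prev c.
Proof.
case=> P Q R S l' _ _ /= h1 h2 i.
case: (h1 i) => [?|h1'|?]; [by apply: Or31; apply/dis_holdsU; left| |by apply: Or33].
case: (h2 i) => [?|h2'|?]; [by apply: Or31; apply/dis_holdsU; right| |by apply: Or33].
by apply: Or32; apply: resolution h1' h2'.
Qed.

Lemma loop_iteration_grows R l prev k g g' :
  loop_iteration R l prev k g g' -> grows (Loop k) g g'.
Proof.
case=> g1 g2 g3 _ app sat [f [_ ->]].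
apply: grows_trans (apply_each_grows app) _.
apply: grows_trans (saturates_grows sat) _.
by split=> //; split=> [|e eg] /=; rewrite ?prefix_refl // mem_cat eg.
Qed.

Lemma found_loop R l prev k g g' :
  loop_iteration R l prev k g g' -> extends g' gf -> found g' k l prev ->
  reaching_holds g ->
  forall v P, labelled g' v (Loop k) (Glob P set0) -> A v ->
  forall i, dis_holds sw i P \/ forall j, i < j -> ~ lit_holds sw j (xlit l).
Proof.
move=> iter fin; have [ext _] := loop_iteration_grows iter.
(* Backward closure is inherited by [g'], so the invariants can be run with [g'] in place of the
   final graph. *)
have closed : backward_closed g' A.
  have [/prefixP[t gt] ge] := fin.
  move=> u v /ge uv ult; apply: backward uv _.
  by rewrite gt size_cat ltn_addr.
have glt v p c : labelled g v p c -> v < size (gverts g').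
  by move/(extends_labelled ext); apply: labelled_lt.
case: iter closed glt {fin ext} => {g'} g1 g2 g3 L0 app sat [f [fP ->]].
set h := Graph _ _ => closed glt fnd up.
have ext2 : extends g2 h.
  by split=> [|e eg]; rewrite ?prefix_refl //= mem_cat eg.
have ext1 : extends g1 h := extends_trans (saturates_grows sat).1 ext2.
(* [h] has the vertices of [g2] and also the loop-it-sub edges. *)
have upL : upheld A (Loop k) (loop_holds h k l prev) g2.
  apply: (saturates_upheld closed sat ext2); first exact: loop_rule_loop_holds.
  apply: (apply_each_upheld closed app ext1) => [c vs|v c lab].
    case=> [v P Q lab _|v P lab|u P Pprev _] ch Ac prem.
    - apply: loop_holdsW; apply: (up _ _ lab); apply: prem; first exact: mem_head.
      exact: glt lab.
    - have Av : A v by apply: prem; [rewrite mem_head|apply: glt lab].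
      move=> i; apply: Or32.
      by have [//|/dis_holds0] := up _ _ lab Av i.+1.
    (* Where a loop-it-init-c clause fails, it is itself the clause to blame. *)
    - move=> i; have [?|nP] := EM (dis_holds sw i.+1 (xlit l |: P)).
        exact: Or32.
      by apply: Or33; exists P.
  (* The iteration starts with an empty loop partition. *)
  by have := labelled_mem lab; have := in_set0 c; rewrite -L0 inE => ->.
have next v P i : labelled g2 v (Loop k) (Glob P set0) -> A v ->
    ~ dis_holds sw i P -> ~ lit_holds sw i.+1 (xlit l) /\
    exists v' P', [/\ labelled g2 v' (Loop k) (Glob P' set0), A v'
                    & ~ dis_holds sw i.+1 P'].
  move=> lab Av nP.
  (* [P] fails and the X part is empty, so only the blamed clause remains. *)
  have [//|/dis_holds0//|[Q [Qprev Qh AQ nQ]]] := upL _ _ lab Av i.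
  move: nQ; rewrite dis_holdsU1 => /not_orP[nl nQ]; split=> //.
  have Qt : Q \in targets g2 k l prev by rewrite inE Qprev inE.
  have := fP Q Qt; case fQ : (f Q) => [v'|]; last first.
    by have [P' P'L P'Q] := fnd Q Qt => /(_ P' P'L) /(_ P'Q).
  case=> P' lab' P'Q; exists v', P'; split=> //.
    (* The recorded loop-it-sub edge runs from [v'] to the blamed vertex. *)
    apply: closed AQ; last exact: labelled_lt lab'.
    rewrite /= mem_cat mem_pmap; apply/orP; right; apply/mapP; exists Q.
      by rewrite mem_enum.
    by rewrite fQ.
  by move=> /(subsumes_dis_holds P'Q).
move=> v P lab Av i; have [|nP] := EM (dis_holds sw i P); [by left|right].
move=> j /subnKC <-; move: (j - i.+1) => d.
elim: d i v P lab Av nP => [|d IHd] i v P lab Av nP.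
  by rewrite addn0; case: (next v P i lab Av nP).
have [_ [v' [P' [lab' Av' nP']]]] := next v P i lab Av nP.
by rewrite addnS; apply: IHd lab' Av' nP'.
Qed.

(** Only the loop partition gains vertices, and [A] is fixed in advance, so the invariant on M is
    untouched. *)
Lemma loop_iteration_main R l prev k g g' :
  loop_iteration R l prev k g g' -> sound_growth g g'.
Proof.
move=> /loop_iteration_grows[ext lab]; split=> // _ up v c lv.
by apply: up; apply: lab lv.
Qed.

Lemma loop_conc_main R l prev k g g1 g2 :
  loop_iteration R l prev k g g1 -> found g1 k l prev ->
  apply_each (loop_conc g1 k R l) Main g1 g2 -> sound_growth g g2.
Proof.
move=> iter fnd app; have [e1 up1] := loop_iteration_main iter.
have [e2 _] := apply_each_grows app.
split=> [|fin2 up]; first exact: extends_trans e1 e2.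
have fin1 := extends_trans e2 fin2.
apply: (apply_each_upheld backward app fin2); last exact: up1.
have glt v p c : labelled g1 v p c -> v < size (gverts gf).
  by move/(extends_labelled fin1); apply: labelled_lt.
have loopP := found_loop iter fin1 fnd up.
move=> c vs [v u P labv labu _ _|v u P labv labu _ _] prem /= i.
  left; rewrite !dis_holdsU dis_holds1.
  have Av : A v by apply: prem (glt _ _ _ labv); rewrite mem_head.
  have Au : A u by apply: prem (glt _ _ _ labu); rewrite !inE eqxx orbT.
  (* If [P] fails at [i], then [l] fails strictly later, so the eventuality clause can be met only
     by [R] at [i] or by [l] at [i] itself. *)
  have [?|nl] := loopP _ _ labv Av i; first by do 2!left.
  have [?|[j]] := up1 fin1 up _ _ labu Au i; first by left; right.
  by rewrite leq_eqVlt => /predU1P[<-|/nl//]; right.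
rewrite dis_holds1 lit_holds_neg dis_holdsU dis_holds1.
have Av : A v by apply: prem (glt _ _ _ labv); rewrite mem_head.
have [wl|] := EM (lit_holds sw i (wlit l)); [right|by left].
(* The loop property is used one position later: [w_l] at [i] supplies an [l] after [i], and if [P]
   fails at [i.+1] that [l] must be at [i.+1]. *)
have [?|nl] := loopP _ _ labv Av i.+1; first by left.
have /lit_holds_wlit[j] := wl.
by rewrite leq_eqVlt => /predU1P[<-|/nl//]; right.
Qed.

Lemma loop_search_main R l prev g g' :
  loop_search R l prev g g' -> sound_growth g g'.
Proof.
elim=> {prev g g'} [prev k g g1 g2 g3 iter fnd app sat
  |prev k g g1 iter _ _|prev k g g1 g2 iter _ _ _].
- apply: sound_growth_trans (loop_conc_main iter fnd app) _.
  exact: saturates_main.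
- exact: loop_iteration_main iter.
- exact: sound_growth_trans (loop_iteration_main iter).
Qed.

Lemma pass_main es g b g' : pass es g b g' -> sound_growth g g'.
Proof.
elim=> {es g b g'} [g|R l es g g' search _|R l es g g1 b g2 search _ _].
- exact: sound_growth_refl.
- exact: loop_search_main search.
- exact: sound_growth_trans (loop_search_main search).
Qed.

Lemma main_loop_main (C : {set clause AP}) M g r g' :
  main_loop C M g r g' -> sound_growth g g'.
Proof.
elim=> {M g r g'} [M g|M es g g1|M es g g1 r g2] _.
- exact: sound_growth_refl.
- by move=> _ /pass_main.
- by move=> _ /pass_main gg1 _; apply: sound_growth_trans.
Qed.

Lemma run_main (C : {set clause AP}) r g : run C r g -> sound_growth (start C) g.
Proof.
case=> {r g} [_|g1 _ /saturates_main//
  |g1 g2 g3 _ /saturates_main s1 _ /augmentation_main s2 /saturates_main s3 _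
  |g1 g2 g3 r g _ /saturates_main s1 _ /augmentation_main s2
    /saturates_main s3 _ /main_loop_main s4].
- exact: sound_growth_refl.
- exact: sound_growth_trans s1 (sound_growth_trans s2 s3).
- apply: sound_growth_trans s1 (sound_growth_trans s2 _).
  exact: sound_growth_trans s3 s4.
Qed.

End Run.

(** * Unsatisfiability of the core *)

Theorem theorem1 (AP : finType) (C : {set clause AP}) (g : graph (atom AP))
    (vbox : vertex g) :
  run C UNSAT g -> box_vertex vbox -> ~ satisfiable (uc C vbox).
Proof.
move=> gP [c cbox labc] [s sP].
(* Reachability is stated on numbers rather than on vertices of [g], so that it applies to the
   intermediate graphs of the run. *)
pose A v := exists2 u : vertex g, val u = v & connect (@edge AP g) u vbox.
have closed : backward_closed g A.
  move=> u v uv ult [w wv w_vbox]; exists (Ordinal ult) => //.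
  by apply: connect_trans w_vbox; apply: connect1; rewrite /edge wv.
have [e0 up] := run_main closed s gP.
have : holds (wait_model s) c.
  apply: (up (extends_refl g) _ _ _ labc); last by exists vbox.
  (* Base of the induction: a start vertex carries a clause of [C], and its path to [vbox] puts that
     clause in the core. *)
  move=> v d lab [u uv u_vbox]; rewrite -{v}uv in lab.
  have /mapP[d' d'C [dE]] := labelled_mem lab.
  rewrite dE; apply: holds_xclause; apply: sP.
  rewrite inE -[d' \in C]mem_enum d'C; apply/existsP; exists u.
  by rewrite -dE (extends_labelled e0 lab).
case/orP: cbox => /eqP-> /=; first exact: dis_holds0.
by move=> /(_ 0)[] /dis_holds0.
Qed.
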